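(* Let $r\ge 2$ be an integer. Then for every $G\in\mathcal{M}_{1/r}(\mathcal{C})$: (a) $e(G)=\left\lceil\left(1+\frac1r\right)v(G)-1\right\rceil=\left\lfloor\left(1+\frac1r\right)v(G)-\frac1r\right\rfloor$; (b) $\delta(G)=2$; (c) $v(G)\not\equiv 1\pmod r$.
   Context: All graphs are finite and simple; $v(G)$, $e(G)$ and $\delta(G)$ denote the number of vertices, the number of edges and the minimum degree of $G$. For an integer $r\ge2$, $\mathcal{R}_{1/r}(\mathcal{C})$ denotes the class of graphs $G$ such that every colouring of $E(G)$ with $r+1$ colours admits a cycle in $G$ (of arbitrary length) whose edges use at most $r$ of the colours. $\mathcal{M}_{1/r}(\mathcal{C})$ is the class of those $G\in\mathcal{R}_{1/r}(\mathcal{C})$ that are minimal with respect to the subgraph relation, i.e. no proper subgraph of $G$ belongs to $\mathcal{R}_{1/r}(\mathcal{C})$. *)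

(* Defs.v *)
From HB Require Import structures.
From mathcomp Require Import all_boot all_order all_algebra.
Set Implicit Arguments.
Unset Strict Implicit.
Unset Printing Implicit Defensive.

(* A finite simple graph whose vertices are drawn from an ambient finite type;
   an edge is the unordered pair of its two distinct endpoints. The vertex set
   is not required to exhaust the ambient type, so that a graph and its
   subgraphs (possibly on fewer vertices) share one type. *)
Record sgraph (T : finType) := SGraph {
  vset : {set T};
  eset : {set {set T}};
  _ : [forall e in eset, (e \subset vset) && (#|e| == 2)]
}.

Definition nv (T : finType) (G : sgraph T) : nat := #|vset G|.

Definition ne (T : finType) (G : sgraph T) : nat := #|eset G|.

Definition deg (T : finType) (G : sgraph T) (x : T) : nat :=
  #|[set e in eset G | x \in e]|.

(* Degrees are smaller than nv G, so the default value nv G is attained only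
   when G has no vertex. *)
Definition min_deg (T : finType) (G : sgraph T) : nat :=
  \big[minn/nv G]_(x in vset G) deg G x.

Definition subgraph (T : finType) (H G : sgraph T) : bool :=
  (vset H \subset vset G) && (eset H \subset eset G).

Definition proper_subgraph (T : finType) (H G : sgraph T) : bool :=
  subgraph H G && ~~ subgraph G H.

Definition adj (T : finType) (G : sgraph T) : rel T :=
  fun x y => [set x; y] \in eset G.

Definition is_cycle (T : finType) (G : sgraph T) (p : seq T) : bool :=
  [&& 3 <= size p, uniq p & cycle (adj G) p].

Definition cycle_edges (T : finType) (p : seq T) : {set {set T}} :=
  [set [set x; next p x] | x in p].

(* A colouring of the edges is given by a map on all sets of vertices, of which
   only the values on eset G matter. *)
Definition ramsey_class (r : nat) (T : finType) (G : sgraph T) : Prop :=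
  forall c : {set T} -> 'I_r.+1,
    exists2 p : seq T, is_cycle G p & #|c @: cycle_edges p| <= r.

Definition minimal_class (r : nat) (T : finType) (G : sgraph T) : Prop :=
  ramsey_class r G /\
  forall H : sgraph T, proper_subgraph H G -> ~ ramsey_class r H.

(* Main.v *)
Require Import Defs.
From HB Require Import structures.
From mathcomp Require Import all_boot all_order all_algebra.
From mathcomp Require Import zify ring lra.
Import Order.TTheory GRing.Theory Num.Theory.

(* A colouring with r+1 colours in which every cycle sees all colours amounts to
   r+1 forests (the complements of the colour classes) covering each edge
   exactly r times. As in the Nash-Williams arboricity theorem, such a covering
   exists if and only if r e(U) <= (r+1)(|U|-1) for every nonempty vertex set U,
   so a minimal graph violates this inequality while all its proper subgraphs
   satisfy it. Deleting an edge then determines e(G), deleting a vertex gives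
   r deg(x) >= r+2, the average degree is below 3, and deleting a vertex of
   degree 2 excludes v(G) = 1 mod r.
   The covering comes from a family of r+1 forests of maximal total size in
   which every edge has multiplicity at most r. If the edge ab has smaller
   multiplicity, let D be the set of edges that have multiplicity below r in
   some family reachable by exchanges; the component of D containing ab is then
   spanned by each of the forests, hence too dense. *)

Set Implicit Arguments.
Unset Strict Implicit.
Unset Printing Implicit Defensive.

(** * Connectivity and forests as edge sets *)

Definition edge_rel (T : finType) (A : {set {set T}}) : rel T :=
  fun x y => [set x; y] \in A.

Definition conn (T : finType) (A : {set {set T}}) : rel T :=
  connect (edge_rel A).

(** A forest is described by the condition that every edge is a bridge. As [conn] is reflexive, this
    also keeps singletons out of [A]. *)
Definition acyclic (T : finType) (A : {set {set T}}) : bool :=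
  [forall x, forall y,
    ([set x; y] \in A) ==> ~~ conn (A :\ [set x; y]) x y].

Lemma conn_sym (T : finType) (A : {set {set T}}) x y : conn A x y = conn A y x.
Proof. by apply: sym_connect_sym => u v; rewrite /edge_rel setUC. Qed.

Lemma conn_trans (T : finType) (A : {set {set T}}) : transitive (conn A).
Proof. exact: connect_trans. Qed.

Lemma conn_edge (T : finType) (A : {set {set T}}) x y :
  [set x; y] \in A -> conn A x y.
Proof. by move=> h; apply: connect1. Qed.

Lemma conn_subrel (T : finType) (A B : {set {set T}}) :
  (forall x y, [set x; y] \in A -> conn B x y) ->
  forall x y, conn A x y -> conn B x y.
Proof. by move=> h; apply: connect_sub. Qed.

Lemma conn_subset (T : finType) (A B : {set {set T}}) x y :
  A \subset B -> conn A x y -> conn B x y.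
Proof.
by move=> sAB; apply: conn_subrel => u v /(subsetP sAB); apply: conn_edge.
Qed.

Lemma set2_inj (T : finType) (x y u v : T) :
  [set x; y] = [set u; v] -> (x = u /\ y = v) \/ (x = v /\ y = u).
Proof.
move=> e.
have := set21 x y; rewrite e => /set2P[] ?; have := set22 x y;
  rewrite e => /set2P[] ?; subst; auto.
- have := set22 u v; rewrite -e => /set2P[] ?; subst; auto.
- have := set21 u v; rewrite -e => /set2P[] ?; subst; auto.
Qed.

Lemma conn_set2 (T : finType) (A : {set {set T}}) x y u v :
  [set x; y] = [set u; v] -> conn A x y = conn A u v.
Proof. by case/set2_inj=> -[-> ->] //; rewrite conn_sym. Qed.

Lemma acyclicP (T : finType) (A : {set {set T}}) :
  reflect (forall x y, [set x; y] \in A -> ~~ conn (A :\ [set x; y]) x y)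
          (acyclic A).
Proof.
apply: (iffP forallP) => [h x y|h x]; first by have /forallP/(_ y)/implyP := h x.
by apply/forallP=> y; apply/implyP/h.
Qed.

Lemma acyclic_subset (T : finType) (A B : {set {set T}}) :
  A \subset B -> acyclic B -> acyclic A.
Proof.
move=> sAB /acyclicP aB; apply/acyclicP=> x y hxy.
apply: contra (aB x y (subsetP sAB _ hxy)).
exact/conn_subset/setSD.
Qed.

Lemma conn_setU1 (T : finType) (A : {set {set T}}) x y u v :
  conn ([set x; y] |: A) u v ->
  [|| conn A u v, conn A u x && conn A y v | conn A u y && conn A x v].
Proof.
case/connectP=> p hp ->; elim: p u hp => [|w p IH] u /=.
  by rewrite /conn connect0.
case/andP=> huw /IH.
move: huw; rewrite /edge_rel in_setU1 => /orP[/eqP/set2_inj[[-> ->]|[-> ->]]|/conn_edge huw].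
- by case/or3P=> [->|/andP[_ ->]|/andP[_ ->]]; rewrite /conn connect0 ?orbT.
- by case/or3P=> [->|/andP[_ ->]|/andP[_ ->]]; rewrite /conn connect0 ?orbT.
case/or3P=> [h|/andP[h ->]|/andP[h ->]]; by rewrite (conn_trans huw h) ?orbT.
Qed.

(** If an old edge [[set u; v]] lay on a cycle through the new edge, the rest of that cycle together
    with [[set u; v]] would already join [x] to [y] in [A]. *)
Lemma acyclic_setU1 (T : finType) (A : {set {set T}}) x y :
  acyclic A -> ~~ conn A x y -> acyclic ([set x; y] |: A).
Proof.
move=> /acyclicP aA nxy; apply/acyclicP=> u v; rewrite in_setU1.
have [euv _|nuv /= uvA] := eqVneq [set u; v] [set x; y].
  rewrite (conn_set2 _ euv) euv; apply: contra nxy; apply: conn_subset.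
  by apply/subsetP=> f; rewrite !inE => /andP[/negPf->].
have -> : ([set x; y] |: A) :\ [set u; v] = [set x; y] |: (A :\ [set u; v]).
  by apply/setP=> f; rewrite !inE; case: (f =P [set x; y]) => // ->; rewrite eq_sym nuv.
have sA a b : conn (A :\ [set u; v]) a b -> conn A a b.
  exact/conn_subset/subsetDl.
apply/negP=> /conn_setU1/or3P[h|/andP[h1 h2]|/andP[h1 h2]].
- by have := aA u v uvA; rewrite h.
- case/negP: nxy; rewrite conn_sym in h1; rewrite conn_sym in h2.
  apply: conn_trans (sA _ _ h1) _; apply: conn_trans (conn_edge uvA) _.
  exact: sA h2.
- case/negP: nxy; apply: conn_trans (sA _ _ h2) _; rewrite conn_sym.
  rewrite conn_sym in h1.
  exact: conn_trans (sA _ _ h1) (conn_edge uvA).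
Qed.

Definition pairs (T : finType) (A : {set {set T}}) : Prop :=
  forall f, f \in A -> #|f| = 2.

(* The edges whose removal separates [x] from [y] are those of the unique path
   between them, here obtained as a minimal connecting edge set. *)
Lemma conn_separating (T : finType) (A : {set {set T}}) x y :
  pairs A -> acyclic A -> conn A x y ->
  conn [set f in A | ~~ conn (A :\ f) x y] x y.
Proof.
move=> pA /acyclicP aA cA.
have P0 : (A \subset A) && conn A x y by rewrite subxx.
case: (@arg_minnP _ A (fun D : {set {set T}} => (D \subset A) && conn D x y)
        (fun D : {set {set T}} => #|D|) P0) => D /andP[sDA cD] minD.
apply: (conn_subset _ cD); apply/subsetP=> f fD; rewrite inE (subsetP sDA _ fD) /=.
have nD : ~~ conn (D :\ f) x y.
  apply/negP=> h; have := minD (D :\ f).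
  rewrite h (subset_trans (subsetDl _ _) sDA) => /(_ isT).
  by rewrite (cardsD1 f D) fD ltnn.
have /eqP/cards2P[u [v [uv ef]]] := pA f (subsetP sDA _ fD).
have fA := subsetP sDA _ fD; rewrite ef in fD fA nD *.
have sD a b : conn (D :\ [set u; v]) a b -> conn (A :\ [set u; v]) a b.
  exact/conn_subset/setSD.
(* In [D] without [[set u; v]], the vertices [x] and [y] are joined to different ends of that edge.
   A connection from [x] to [y] avoiding the edge would then join its ends, although it is a bridge
   of [A]. *)
apply: contra (aA u v fA) => h.
have : conn ([set u; v] |: (D :\ [set u; v])) x y by rewrite setD1K.
case/conn_setU1/or3P=> [h1|/andP[h1 h2]|/andP[h1 h2]].
- by rewrite h1 in nD.
- rewrite conn_sym in h1; rewrite conn_sym in h2.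
  exact: conn_trans (conn_trans (sD _ _ h1) h) (sD _ _ h2).
- rewrite conn_sym in h.
  exact: conn_trans (conn_trans (sD _ _ h2) h) (sD _ _ h1).
Qed.

(** * Edge counts of components and of forests *)

(** The component is grown from [x] one vertex at a time, and each new vertex brings a new edge
    inside the grown set. *)
Lemma card_conn (T : finType) (A : {set {set T}}) x :
  #|[set z | conn A x z]|
    <= #|[set f in A | f \subset [set z | conn A x z]]|.+1.
Proof.
set U := [set z | conn A x z].
have grow n : n < #|U| -> exists W : {set T},
    [/\ x \in W, W \subset U, #|W| = n.+1 & n <= #|[set f in A | f \subset W]|].
  elim: n => [|n IH] hn.
    exists [set x]; rewrite set11 cards1 sub1set inE; split=> //.
    by rewrite /conn connect0.
  have [W [xW sWU cW hW]] := IH (ltnW hn).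
  have /existsP[w /existsP[z /and3P[wW zW wz]]] :
      [exists w, exists z, [&& w \in W, z \notin W & [set w; z] \in A]].
    apply: contraT => /existsPn hno.
    have cl : closed (edge_rel A) W.
      apply: intro_closed => [|a b ab aW]; first exact: conn_sym.
      apply: contraT => bW; have /existsPn/(_ b) := hno a.
      by rewrite aW bW; move: ab; rewrite /edge_rel => ->.
    have sUW : U \subset W.
      by apply/subsetP=> z; rewrite inE => /(closed_connect cl) <-.
    by have := leq_trans hn (subset_leq_card sUW); rewrite cW ltnn.
  exists (z |: W); rewrite cardsU1 zW cW inE xW orbT; split=> //.
    rewrite subUset sWU sub1set inE andbT.
    have := subsetP sWU _ wW; rewrite inE => h.
    exact: conn_trans h (conn_edge wz).
  apply: leq_ltn_trans hW _; apply: proper_card; apply/properP; split.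
    apply/subsetP=> f; rewrite !inE => /andP[-> fW] /=.
    exact: subset_trans fW (subsetUr _ _).
  exists [set w; z]; first by rewrite inE wz subUset !sub1set !inE wW eqxx !orbT.
  by rewrite inE wz subUset !sub1set (negPf zW) andbF.
case cU : #|U| => [//|n].
have [|W [xW sWU cW hW]] := grow n; first by rewrite cU.
have eWU : W = U by apply/eqP; rewrite eqEcard sWU cU cW leqnn.
by rewrite -eWU ltnS.
Qed.

(** Induction on the size of [V]: removing an edge [[set x; y]] leaves no edge between the component
    [C] of [x] and its complement, and both parts of [V] are nonempty. *)
Lemma card_acyclic (T : finType) (V : {set T}) (A : {set {set T}}) :
  pairs A -> acyclic A -> (forall f, f \in A -> f \subset V) ->
  #|A| <= #|V|.-1.
Proof.
have [n] := ubnP #|V|; elim: n V A => // n IH V A hn pA aA sAV.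
have [->|[f fA]] := set_0Vmem A; first by rewrite cards0.
have /eqP/cards2P[x [y [xy ef]]] := pA f fA; subst f.
have nxy := acyclicP _ aA x y fA.
move defB: (A :\ [set x; y]) nxy => B nxy.
have sBA : B \subset A by rewrite -defB subsetDl.
set C := [set z | conn B x z].
have := sAV _ fA; rewrite subUset !sub1set => /andP[xV yV].
have clC u v : [set u; v] \in B -> u \in C -> v \in C.
  by rewrite !inE => /conn_edge h1 h2; apply: conn_trans h2 h1.
have xC : x \in C by rewrite inE /conn connect0.
have yC : y \notin C by rewrite inE.
pose B1 := [set f in B | f \subset V :&: C].
pose B2 := [set f in B | f \subset V :\: C].
have sB : B \subset B1 :|: B2.
  apply/subsetP=> f fB; rewrite !inE fB /=.
  have fAA := subsetP sBA _ fB.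
  have /eqP/cards2P[u [v [uv ef]]] := pA f fAA; subst f.
  have := sAV _ fAA; rewrite !subUset !sub1set !inE => /andP[-> ->].
  have h1 := clC u v fB; rewrite setUC in fB; have h2 := clC v u fB.
  rewrite !inE in h1 h2; rewrite !andbT /=.
  have -> : conn B x u = conn B x v by apply/idP/idP.
  by case: (conn B x v).
have cV : #|V :&: C| + #|V :\: C| = #|V| by rewrite cardsID.
have c1 : 0 < #|V :&: C| by apply/card_gt0P; exists x; rewrite inE xV.
have c2 : 0 < #|V :\: C| by apply/card_gt0P; exists y; rewrite inE yC yV.
have l1 : #|B1| <= #|V :&: C|.-1.
  apply: IH; first by lia.
  - by move=> f; rewrite inE => /andP[/(subsetP sBA) /pA].
  - by apply: acyclic_subset aA; apply/subsetP=> f; rewrite inE => /andP[/(subsetP sBA)].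
  - by move=> f; rewrite inE => /andP[].
have l2 : #|B2| <= #|V :\: C|.-1.
  apply: IH; first by lia.
  - by move=> f; rewrite inE => /andP[/(subsetP sBA) /pA].
  - by apply: acyclic_subset aA; apply/subsetP=> f; rewrite inE => /andP[/(subsetP sBA)].
  - by move=> f; rewrite inE => /andP[].
have := cardsD1 [set x; y] A; rewrite fA defB add1n => ->.
have := leq_trans (subset_leq_card sB) (leq_card_setU _ _).
by move: cV c1 c2 l1 l2; move: #|_| #|_| #|_| #|_| #|_| #|_|; lia.
Qed.

(** * Families of forests with bounded multiplicity *)

(* A set of pairs (i, f) encodes the family of edge sets [fib S i]. *)
Definition fib (I T : finType) (S : {set I * {set T}}) (i : I) : {set {set T}} :=
  [set f | (i, f) \in S].

Definition load (I T : finType) (S : {set I * {set T}}) (f : {set T}) : nat :=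
  #|[set i | (i, f) \in S]|.

Definition packing (I T : finType) (E : {set {set T}}) (r : nat)
    (S : {set I * {set T}}) : bool :=
  [&& [forall p in S, p.2 \in E], [forall i, acyclic (fib S i)]
    & [forall f, load S f <= r]].

Lemma packingP (I T : finType) (E : {set {set T}}) r (S : {set I * {set T}}) :
  reflect [/\ forall i f, f \in fib S i -> f \in E,
              forall i, acyclic (fib S i) & forall f, load S f <= r]
          (packing E r S).
Proof.
apply: (iffP and3P) => [[/forall_inP h1 /forallP h2 /forallP h3]|[h1 h2 h3]].
  by split=> // i f; rewrite inE => /h1.
split; [|exact/forallP|exact/forallP].
by apply/forall_inP=> -[i f] hf; apply: (h1 i); rewrite inE.
Qed.

Lemma load_subset (I T : finType) (S S' : {set I * {set T}}) f :
  S' \subset S -> load S' f <= load S f.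
Proof.
move=> sS; apply: subset_leq_card.
by apply/subsetP=> i; rewrite !inE => /(subsetP sS).
Qed.

Lemma packing_subset (I T : finType) (E : {set {set T}}) r
    (S S' : {set I * {set T}}) :
  S' \subset S -> packing E r S -> packing E r S'.
Proof.
move=> sS /packingP[h1 h2 h3].
have sF i : fib S' i \subset fib S i.
  by apply/subsetP=> f; rewrite !inE => /(subsetP sS).
apply/packingP; split=> [i f /(subsetP (sF i))/h1 //|i|f].
- exact: acyclic_subset (sF i) (h2 i).
- exact: leq_trans (load_subset f sS) (h3 f).
Qed.

Lemma packing_setU1 (I T : finType) (E : {set {set T}}) r
    (S : {set I * {set T}}) i f :
  packing E r S -> f \in E -> load S f < r -> acyclic (f |: fib S i) ->
  packing E r ((i, f) |: S).
Proof.
move=> /packingP[h1 h2 h3] fE lf aF; apply/packingP; split=> [j g|j|g].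
- by rewrite !inE => /orP[/eqP[_ ->] //|h]; apply: (h1 j); rewrite inE.
- have [->|nij] := eqVneq j i.
    apply: acyclic_subset aF; apply/subsetP=> g.
    by rewrite !inE xpair_eqE eqxx.
  apply: acyclic_subset (h2 j); apply/subsetP=> g.
  by rewrite !inE xpair_eqE (negPf nij).
- have [->|ngf] := eqVneq g f.
    apply: leq_trans lf; rewrite /load.
    have -> : [set j | (j, f) \in (i, f) |: S] = i |: [set j | (j, f) \in S].
      by apply/setP=> j; rewrite !inE xpair_eqE eqxx andbT.
    by rewrite cardsU1; case: (_ \notin _).
  apply: leq_trans (h3 g); apply: subset_leq_card; apply/subsetP=> j.
  by rewrite !inE xpair_eqE (negPf ngf) andbF.
Qed.

(** * Exchanges in a maximal packing *)

(** An edge of too small multiplicity enters forest [i] in place of [e]. When [x] and [y] are joined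
    in that forest, [e] is an edge of the path between them, so the result is again a forest. *)
Definition exchange (I T : finType) (E : {set {set T}}) (r : nat) :
    rel {set I * {set T}} := fun S S' =>
  [exists i, exists x, exists y, exists e,
    [&& [set x; y] \in E, load S [set x; y] < r, [set x; y] \notin fib S i,
        e \in fib S i, ~~ conn (fib S i :\ e) x y
      & S' == (i, [set x; y]) |: (S :\ (i, e))]].

Lemma exchangeP (I T : finType) (E : {set {set T}}) r (S S' : {set I * {set T}}) :
  reflect (exists i x y e, [/\ [set x; y] \in E, load S [set x; y] < r,
             [set x; y] \notin fib S i,
             e \in fib S i /\ ~~ conn (fib S i :\ e) x y
           & S' = (i, [set x; y]) |: (S :\ (i, e))])
          (exchange E r S S').
Proof.
apply: (iffP existsP) => [[i /existsP[x /existsP[y /existsP[e]]]]|[i [x [y [e]]]]].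
  by case/and5P=> ? ? ? ? /andP[? /eqP ?]; exists i, x, y, e.
case=> h1 h2 h3 [h4 h5] ->; exists i; apply/existsP; exists x; apply/existsP.
by exists y; apply/existsP; exists e; rewrite h1 h2 h3 h4 h5 eqxx.
Qed.

Lemma exchange_packing (I T : finType) (E : {set {set T}}) r
    (S S' : {set I * {set T}}) :
  exchange E r S S' -> packing E r S -> packing E r S' /\ #|S'| = #|S|.
Proof.
case/exchangeP=> i [x [y [e [xyE lxy nxy [eS sep] ->]]]] pS; split.
  apply: packing_setU1 => //.
  - exact: packing_subset (subsetDl _ _) pS.
  - exact: leq_ltn_trans (load_subset _ (subsetDl _ _)) lxy.
  - have -> : fib (S :\ (i, e)) i = fib S i :\ e.
      by apply/setP=> f; rewrite !inE xpair_eqE eqxx.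
    apply: acyclic_setU1 sep; case/packingP: pS => _ h _.
    exact: acyclic_subset (subsetDl _ _) (h i).
rewrite !inE in eS nxy.
by rewrite cardsU1 !inE (negPf nxy) andbF (cardsD1 (i, e) S) eS.
Qed.

Lemma connect_exchange_packing (I T : finType) (E : {set {set T}}) r
    (S S' : {set I * {set T}}) :
  connect (exchange E r) S S' -> packing E r S -> packing E r S' /\ #|S'| = #|S|.
Proof.
case/connectP=> p hp ->; elim: p S hp => //= S1 p IH S /andP[h hp] pS.
have [pS1 <-] := exchange_packing h pS.
exact: IH.
Qed.

Definition deficient (I T : finType) (E : {set {set T}}) (r : nat)
    (S0 : {set I * {set T}}) : {set {set T}} :=
  [set f in E | [exists S, connect (exchange E r) S0 S && (load S f < r)]].

Lemma deficient_connect (I T : finType) (E : {set {set T}}) r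
    (S0 S : {set I * {set T}}) f :
  connect (exchange E r) S0 S -> f \in E -> load S f < r ->
  f \in deficient E r S0.
Proof. by move=> cS fE lf; rewrite inE fE; apply/existsP; exists S; rewrite cS. Qed.

(** If the edge is not in forest [i], maximality forces its ends to be joined there, since otherwise
    it could be added. Every edge of the joining path can be exchanged for it and then has
    multiplicity below [r], so the path is deficient. *)
Lemma conn_load_lt (I T : finType) (E : {set {set T}}) r
    (S0 S : {set I * {set T}}) i x y :
  pairs E -> packing E r S0 ->
  (forall S' : {set I * {set T}}, packing E r S' -> #|S'| <= #|S0|) ->
  connect (exchange E r) S0 S -> [set x; y] \in E -> load S [set x; y] < r ->
  conn (fib S i :&: deficient E r S0) x y.
Proof.
move=> pE pS0 max0 cS xyE lxy.
have [xyS|nxyS] := boolP ([set x; y] \in fib S i).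
  by apply: conn_edge; rewrite in_setI xyS (deficient_connect cS).
have [pS cardS] := connect_exchange_packing cS pS0.
have [sE aS lS] := packingP _ _ _ pS.
have cxy : conn (fib S i) x y.
  apply: contraT => nc.
  have := max0 _ (packing_setU1 pS xyE lxy (acyclic_setU1 (aS i) nc)).
  by rewrite cardsU1 cardS; rewrite inE in nxyS; rewrite nxyS ltnn.
apply: conn_subset (conn_separating _ (aS i) cxy); last by move=> f /sE/pE.
apply/subsetP=> e; rewrite inE => /andP[eS sep].
rewrite in_setI eS /=.
have st : exchange E r S ((i, [set x; y]) |: (S :\ (i, e))).
  by apply/exchangeP; exists i, x, y, e.
apply: (deficient_connect (connect_trans cS (connect1 st))); first exact: sE eS.
apply: leq_trans (lS e); apply: proper_card; apply/properP; split.
  apply/subsetP=> j; rewrite !inE !xpair_eqE => /orP[/andP[_ /eqP h]|/andP[]//].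
  by move: eS lxy (lS e); rewrite h => xyS; rewrite xyS in nxyS.
rewrite !inE in eS nxyS; exists i; rewrite !inE // !xpair_eqE !eqxx orbF /=.
by apply: contra nxyS => /eqP <-.
Qed.

(* An exchange only inserts an edge whose ends are already joined by deficient
   edges in the same forest, so connections can be pulled back along exchanges
   to [S0]. *)
Lemma conn_deficient (I T : finType) (E : {set {set T}}) r
    (S0 : {set I * {set T}}) i x y :
  pairs E -> packing E r S0 ->
  (forall S' : {set I * {set T}}, packing E r S' -> #|S'| <= #|S0|) ->
  [set x; y] \in deficient E r S0 ->
  conn (fib S0 i :&: deficient E r S0) x y.
Proof.
move=> pE pS0 max0; rewrite {1}inE => /andP[xyE /existsP[S /andP[cS lxy]]].
have {lxy xyE} := conn_load_lt i pE pS0 max0 cS xyE lxy.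
suff main p S1 : connect (exchange E r) S0 S1 -> path (exchange E r) S1 p ->
    conn (fib (last S1 p) i :&: deficient E r S0) x y ->
    conn (fib S1 i :&: deficient E r S0) x y.
  by case/connectP: cS => p hp ->; apply: main.
elim: p S1 => //= S2 p IH S1 cS1 /andP[st hp].
move/(IH _ (connect_trans cS1 (connect1 st)) hp).
apply: conn_subrel => u v; rewrite in_setI => /andP[].
case/exchangeP: st => j [a [b [e [abE lab nab [eS sep] ->]]]].
rewrite !inE xpair_eqE => /orP[/andP[/eqP-> /eqP h _]|/andP[_ h] hd].
  by rewrite (conn_set2 _ h); apply: conn_load_lt.
by apply: conn_edge; rewrite !inE h.
Qed.

(** * From a maximal packing to a colouring or a dense vertex set *)

Lemma sum_card_fib (I T : finType) (P : pred {set T}) (S : {set I * {set T}}) :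
  \sum_i #|[set f in fib S i | P f]| = \sum_(f | P f) load S f.
Proof.
under eq_bigr => i _ do rewrite -sum1dep_card.
under [RHS]eq_bigr => f _ do rewrite /load -sum1dep_card.
rewrite (exchange_big_dep P) //=; last by move=> i f _ /andP[].
by apply: eq_bigr => f Pf; apply: eq_bigl => i; rewrite inE Pf andbT.
Qed.

Lemma deficient_dense (T : finType) (E : {set {set T}}) r
    (S0 : {set 'I_r.+1 * {set T}}) f :
  pairs E -> packing E r S0 ->
  (forall S' : {set 'I_r.+1 * {set T}}, packing E r S' -> #|S'| <= #|S0|) ->
  f \in E -> load S0 f < r ->
  exists U : {set T}, r.+1 * #|U|.-1 < r * #|[set f in E | f \subset U]|.
Proof.
move=> pE pS0 max0 fE lf.
have [sE aS lS] := packingP _ _ _ pS0.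
have /eqP/cards2P[a [b [ab ef]]] := pE f fE; subst f.
set D := deficient E r S0.
have abD : [set a; b] \in D by apply: deficient_connect lf.
pose U := [set z | conn D a z]; exists U.
have aU : [set a; b] \subset U.
  by rewrite subUset !sub1set !inE /conn connect0; apply: conn_edge.
have cF i : #|U|.-1 <= #|[set f in fib S0 i | (f \in E) && (f \subset U)]|.
  (* By [conn_deficient], the deficient edges of each single forest already span the component
     [U]. *)
  have eU : U = [set z | conn (fib S0 i :&: D) a z].
    apply/setP=> z; rewrite !inE; apply/idP/idP.
      by apply: conn_subrel => x y; apply: conn_deficient.
    exact/conn_subset/subsetIr.
  have := card_conn (fib S0 i :&: D) a; rewrite -eU.
  move=> h; rewrite -subn1 leq_subLR add1n; apply: leq_trans h _.
  rewrite ltnS; apply: subset_leq_card; apply/subsetP=> g.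
  rewrite !in_set => /andP[/andP[h1 _] ->]; rewrite h1 andbT /=.
  by apply: (sE i); rewrite inE.
have : r.+1 * #|U|.-1 <= \sum_(f | (f \in E) && (f \subset U)) load S0 f.
  rewrite -sum_card_fib -{1}(card_ord r.+1) -sum_nat_const.
  by apply: leq_sum => i _.
move/leq_ltn_trans; apply.
(* All loads are at most [r], and that of [[set a; b]] is smaller; splitting it off makes the
   inequality strict. *)
rewrite mulnC -sum_nat_const (bigD1 [set a; b]) /= ?fE //.
rewrite [X in _ < X](bigD1 [set a; b]) /= ?inE ?fE //.
rewrite -addSn leq_add //.
rewrite (eq_bigl (fun f => (f \in [set f0 in E | f0 \subset U]) && (f != [set a; b]))).
  by apply: leq_sum.
by move=> g; rewrite inE.
Qed.

(** If a maximal packing covers each edge exactly [r] times, each edge is missed by exactly one of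
    the [r.+1] forests, whose index becomes its colour. Edges of colour other than [i] then lie in
    forest [i]. *)
Lemma colouring_or_dense (T : finType) (E : {set {set T}}) r :
  pairs E ->
  (exists c : {set T} -> 'I_r.+1, forall i, acyclic [set f in E | c f != i]) \/
  (exists U : {set T}, r.+1 * #|U|.-1 < r * #|[set f in E | f \subset U]|).
Proof.
move=> pE.
have P0 : packing E r (set0 : {set 'I_r.+1 * {set T}}).
  apply/packingP; split=> [i f|i|f]; rewrite ?inE //.
    by apply/acyclicP=> x y; rewrite !inE.
  rewrite /load (_ : [set i | _] = set0) ?cards0 //.
  by apply/setP=> i; rewrite !inE.
case: (@arg_maxnP _ set0 (packing E r) (fun S : {set 'I_r.+1 * {set T}} => #|S|) P0)
  => S pS maxS.
have [/existsP[f /andP[fE lf]]|/existsPn full] :=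
  boolP [exists f, (f \in E) && (load S f < r)].
  by right; apply: deficient_dense pE pS _ fE lf.
left; have [sE aS lS] := packingP _ _ _ pS.
(* The default [ord0] is never reached: a load is at most [r], so some index is missing. *)
exists (fun f => odflt ord0 [pick i | (i, f) \notin S]) => i.
apply: acyclic_subset (aS i); apply/subsetP=> f; rewrite !inE => /andP[fE].
have lr : load S f = r.
  by apply/eqP; rewrite eqn_leq lS leqNgt; have := full f; rewrite fE.
apply: contraR => nif.
case: pickP => [j njf /=|]; last by move/(_ i); rewrite nif.
have : #|~: [set k | (k, f) \in S]| = 1.
  by have := cardsC [set k | (k, f) \in S]; rewrite -/(load S f) lr card_ord; lia.
move/eqP/cards1P=> [k hk].
have := in_set1 i k; have := in_set1 j k; rewrite -hk !inE nif njf.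
by move=> /esym/eqP-> /esym/eqP->.
Qed.

(** * Cycles as vertex sequences versus acyclic edge sets *)

Lemma conn_path_avoiding (T : finType) (A : {set {set T}}) x y u s :
  path (edge_rel A) u s -> x \notin u :: s ->
  conn (A :\ [set x; y]) u (last u s).
Proof.
elim: s u => [|w s IH] u /=; first by rewrite /conn connect0.
case/andP=> uw ps; rewrite inE negb_or => /andP[xu xs].
apply: conn_trans (IH _ ps xs); apply: conn_edge; rewrite inE (uw : _ \in A) andbT inE.
apply/eqP=> e; have := set21 x y; rewrite -e => /set2P[] ?; subst.
  by rewrite eqxx in xu.
by rewrite mem_head in xs.
Qed.

Lemma cycle_not_acyclic (T : finType) (A : {set {set T}}) (p : seq T) :
  2 < size p -> uniq p -> cycle (edge_rel A) p -> ~~ acyclic A.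
Proof.
case: p => [|x [|y [|z q]]] // _ up cp.
apply/negP=> /acyclicP aA.
have /andP[xy pp] : edge_rel A x y && path (edge_rel A) y (rcons (z :: q) x) := cp.
rewrite rcons_path in pp; case/andP: pp => pp lx.
case/andP: up => xN up.
case/negP: (aA x y xy); rewrite conn_sym.
apply: conn_trans (conn_path_avoiding y pp xN) _.
apply: conn_edge; rewrite inE (lx : _ \in A) andbT inE.
(* The closing edge differs from the first edge [[set x; y]] because the cycle has at least three
   distinct vertices. *)
apply/eqP=> /set2_inj[[_ e]|[e _]].
  by rewrite e mem_head in xN.
by case/andP: up; rewrite -{1}e /= mem_last.
Qed.

(** An edge that is not a bridge closes a shortest-form path between its ends. This path has an
    inner vertex, as the ends differ and the edge itself was removed. *)
Lemma not_acyclic_cycle (T : finType) (A : {set {set T}}) :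
  pairs A -> ~~ acyclic A ->
  exists p : seq T, [/\ 2 < size p, uniq p & cycle (edge_rel A) p].
Proof.
move=> pA /forallPn[x /forallPn[y]]; rewrite negb_imply negbK => /andP[xy].
case/connectP=> p0 /shortenP[p pp up _] ey.
exists (x :: p); split=> //; last first.
  rewrite /= rcons_path -ey; apply/andP; split; last by rewrite /edge_rel setUC.
  by apply: sub_path pp => a b; rewrite /edge_rel inE => /andP[].
case: p pp up ey => [|z [|]] //= => [_ _ ey|].
  by have := pA _ xy; rewrite ey setUid cards1.
by rewrite andbT /edge_rel !inE => /andP[/eqP h _] _ ey; case: h; rewrite ey.
Qed.

Lemma cycle_edges_subset (T : finType) (A : {set {set T}}) (p : seq T) :
  cycle (edge_rel A) p -> cycle_edges p \subset A.
Proof.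
move=> cp; apply/subsetP=> f /imsetP[x xp ->].
exact: (next_cycle cp).
Qed.

Lemma cycle_edge_rel (T : finType) (A : {set {set T}}) (p : seq T) :
  uniq p -> cycle_edges p \subset A -> cycle (edge_rel A) p.
Proof.
move=> up sA; apply: cycle_from_next => // x xp.
by apply: (subsetP sA); apply: imset_f.
Qed.

(** * The Ramsey class and density *)

Lemma esetP (T : finType) (G : sgraph T) f :
  f \in eset G -> f \subset vset G /\ #|f| = 2.
Proof.
by case: G => V E h fE; case/andP: (forall_inP h f fE) => ? /eqP ?.
Qed.

Lemma pairs_eset (T : finType) (G : sgraph T) : pairs (eset G).
Proof. by move=> f /esetP[]. Qed.

(** A cycle in some [F i] misses colour [i]. If all [F i] were forests, the bound on their sizes
    would contradict density, as each edge lies in exactly [r] of them. *)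
Lemma dense_ramsey (r : nat) (T : finType) (G : sgraph T) :
  r.+1 * (nv G).-1 < r * ne G -> ramsey_class r G.
Proof.
move=> dG c; pose F i := [set f in eset G | c f != i].
have pF i : pairs (F i) by move=> f; rewrite inE => /andP[/pairs_eset].
have [/existsP[i]|/existsPn aF] := boolP [exists i, ~~ acyclic (F i)].
  case/(not_acyclic_cycle (pF i)) => p [p3 up cp]; exists p.
    rewrite /is_cycle p3 up; apply: sub_cycle cp => a b.
    by rewrite /edge_rel inE => /andP[].
  have : c @: cycle_edges p \subset ~: [set i].
    apply/subsetP=> _ /imsetP[f /(subsetP (cycle_edges_subset cp)) fF ->].
    by move: fF; rewrite !inE => /andP[].
  by move/subset_leq_card; rewrite cardsC1 card_ord.
have : \sum_(i < r.+1) #|F i| <= r.+1 * (nv G).-1.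
  rewrite -[X in X * _]card_ord -sum_nat_const; apply: leq_sum => i _.
  apply: card_acyclic => //; first by have := aF i; rewrite negbK.
  by move=> f; rewrite inE => /andP[/esetP[]].
under eq_bigr => i _ do rewrite -sum1dep_card.
rewrite (exchange_big_dep (mem (eset G))) /=; last by move=> i f _ /andP[].
under eq_bigr => f fE.
  rewrite (eq_bigl (fun i => i \in ~: [set c f])); last first.
    by move=> i; rewrite fE !inE eq_sym.
  rewrite sum1_card cardsC1 card_ord /=.
  over.
by rewrite sum_nat_const mulnC leqNgt dG.
Qed.

(** If the complement of every colour class is a forest, no cycle misses a colour; this rules out
    the first alternative of [colouring_or_dense]. *)
Lemma ramsey_dense_set (r : nat) (T : finType) (G : sgraph T) :
  ramsey_class r G ->
  exists U : {set T}, r.+1 * #|U|.-1 < r * #|[set f in eset G | f \subset U]|.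
Proof.
move=> rG; case: (@colouring_or_dense T (eset G) r (@pairs_eset T G)) => // -[c ac].
have [p /and3P[p3 up cp] hp] := rG c.
have [i iN] : exists i, i \notin c @: cycle_edges p.
  apply/existsP; apply: contraT => /existsPn h.
  have e : c @: cycle_edges p = setT.
    by apply/setP=> i; rewrite inE; have := h i; rewrite negbK.
  by rewrite e cardsT card_ord ltnn in hp.
suff cpi : cycle (edge_rel [set f in eset G | c f != i]) p.
  by have := cycle_not_acyclic p3 up cpi; rewrite ac.
apply: cycle_edge_rel up _; apply/subsetP=> f fp; rewrite inE.
rewrite (subsetP (cycle_edges_subset cp) _ fp) /=.
by apply: contra iN => /eqP <-; apply: imset_f.
Qed.

Lemma sgraph_proof (T : finType) (G : sgraph T) (V : {set T}) (E : {set {set T}}) :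
  E \subset eset G -> (forall f, f \in E -> f \subset V) ->
  [forall e in E, (e \subset V) && (#|e| == 2)].
Proof.
move=> sE sV; apply/forall_inP=> f fE; rewrite sV //=.
by apply/eqP; apply: (@pairs_eset _ G); apply: (subsetP sE).
Qed.

(** * Density of minimal graphs and sparsity of their subgraphs *)

(** The subgraph induced on a dense set is itself in the class, so by minimality it is all of
    [G]. *)
Lemma minimal_dense (r : nat) (T : finType) (G : sgraph T) :
  minimal_class r G -> r.+1 * (nv G).-1 < r * ne G.
Proof.
case=> /ramsey_dense_set[U dU] minG.
set E := [set f in eset G | f \subset U] in dU.
have sE : E \subset eset G by apply/subsetP=> f; rewrite inE => /andP[].
(* The set [U] may contain points outside [vset G]; intersecting keeps all the edges and can only
   increase the density. *)
have sV f : f \in E -> f \subset vset G :&: U.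
  by rewrite inE subsetI => /andP[/esetP[-> _] ->].
pose H := SGraph (sgraph_proof sE sV).
have rH : ramsey_class r H.
  apply: dense_ramsey; rewrite /nv /ne /=; apply: leq_ltn_trans dU.
  rewrite leq_mul2l -!subn1 leq_sub2r ?orbT //.
  exact: subset_leq_card (subsetIr _ _).
have [/(minG H)//|] := boolP (proper_subgraph H G).
rewrite /proper_subgraph /subgraph /= subsetIl sE /= negbK subsetI subxx /=.
case/andP=> sVU sEE; apply: leq_ltn_trans (leq_trans dU _).
  rewrite leq_mul2l -!subn1 leq_sub2r ?orbT //; exact: subset_leq_card.
by rewrite leq_mul2l subset_leq_card ?orbT.
Qed.

Lemma minimal_sparse (r : nat) (T : finType) (G : sgraph T)
    (V : {set T}) (E : {set {set T}}) :
  minimal_class r G -> V \subset vset G -> E \subset eset G ->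
  (forall f, f \in E -> f \subset V) ->
  (V != vset G) || (E != eset G) ->
  r * #|E| <= r.+1 * #|V|.-1.
Proof.
case=> _ minG sV sE sEV nE; rewrite leqNgt; apply/negP=> d.
apply: (minG (SGraph (sgraph_proof sE sEV))); last exact: dense_ramsey.
rewrite /proper_subgraph /subgraph /= sV sE /=.
apply: contraL nE => /andP[hV hE].
by rewrite !eqEsubset sV sE hV hE.
Qed.

Lemma minimal_edge_bound (r : nat) (T : finType) (G : sgraph T) :
  minimal_class r G -> r * ne G <= r.+1 * (nv G).-1 + r.
Proof.
move=> mG; have [e0|[f fE]] := set_0Vmem (eset G).
  by rewrite /ne e0 cards0 muln0.
rewrite /ne (cardsD1 f) fE mulnDr muln1 addnC leq_add2r.
apply: (minimal_sparse mG) => //; first exact: subsetDl.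
  by move=> g; rewrite inE => /andP[_ /esetP[]].
by rewrite orbC; apply/orP; left; apply/eqP=> h; move: fE; rewrite -h !inE eqxx.
Qed.

Lemma minimal_deg_bound (r : nat) (T : finType) (G : sgraph T) x :
  minimal_class r G -> x \in vset G ->
  r * ne G <= r.+1 * (nv G).-2 + r * deg G x.
Proof.
move=> mG xV.
have -> : ne G = #|[set f in eset G | x \notin f]| + deg G x.
  rewrite /ne -(cardsID [set f : {set T} | x \in f]) addnC; congr (_ + _); apply: eq_card => f.
    by rewrite !inE andbC.
  by rewrite !inE.
rewrite mulnDr leq_add2r.
have -> : (nv G).-2 = #|vset G :\ x|.-1 by rewrite /nv (cardsD1 x) xV.
apply: (minimal_sparse mG); first exact: subsetDl.
- by apply/subsetP=> f; rewrite inE => /andP[].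
- move=> f; rewrite inE => /andP[/esetP[sf _] xf]; apply/subsetP=> z zf.
  by rewrite !inE (subsetP sf _ zf) andbT; apply: contraNneq xf => <-.
- by apply/orP; left; apply/eqP=> h; move: xV; rewrite -h !inE eqxx.
Qed.

Lemma handshake (T : finType) (G : sgraph T) :
  \sum_(x in vset G) deg G x = 2 * ne G.
Proof.
under eq_bigr => x _ do rewrite /deg -sum1dep_card.
rewrite (exchange_big_dep (mem (eset G))) /=; last by move=> x f _ /andP[].
under eq_bigr => f fE.
  rewrite (eq_bigl (mem f)); last first.
    move=> x /=; rewrite fE /=; case: (boolP (x \in f)); rewrite ?andbF ?andbT //.
    by have [/subsetP s _] := esetP fE => /s.
  rewrite sum1_card; have [_ ->] := esetP fE.
  over.
by rewrite sum_nat_const mulnC.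
Qed.

(** * Arithmetic and the conclusion *)

(** With [n = r.+1 * v] the hypotheses say [r * e + 1 <= n <= r * e + r], so [e] is both the ceiling
    of [n / r - 1] and the floor of [(n - 1) / r]. *)
Lemma ceil_floor_bounds (r v e : nat) :
  0 < r -> r.+1 * v <= r * e + r -> r * e < r.+1 * v ->
  e%:Z%R = Num.ceil ((1 + 1 / r%:R) * v%:R - 1 : rat)%R /\
  e%:Z%R = Num.floor ((1 + 1 / r%:R) * v%:R - 1 / r%:R : rat)%R.
Proof.
move=> r0 lo hi; have R0 : (0 < r%:R :> rat)%R by rewrite ltr0n.
have Rn0 : (r%:R != 0 :> rat)%R by rewrite gt_eqF.
have -> : ((1 + 1 / r%:R) * v%:R - 1 = (r.+1 * v)%:R / r%:R - 1 :> rat)%R.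
  by rewrite natrM -natr1; field.
have -> : ((1 + 1 / r%:R) * v%:R - 1 / r%:R = ((r.+1 * v)%:R - 1) / r%:R :> rat)%R.
  by rewrite natrM -natr1; field.
move: (r.+1 * v) lo hi => n lo hi.
have {}lo : (n%:R <= e%:R * r%:R + r%:R :> rat)%R.
  by rewrite -natrM -natrD ler_nat mulnC.
have {}hi : (e%:R * r%:R + 1 <= n%:R :> rat)%R.
  by rewrite -natrM natr1 ler_nat mulnC.
split; apply/esym; [apply: ceil_def|apply: floor_def]; apply/andP; split.
- by rewrite rmorphB /= ltrD2r ltr_pdivlMr //; lra.
- by rewrite lerBlDr ler_pdivrMr // mulrDl mul1r.
- by rewrite ler_pdivlMr //; lra.
- by rewrite rmorphD /= ltr_pdivrMr //; lra.
Qed.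

(** The bound [d <= nv G] takes care of the default value of the minimum. *)
Lemma min_deg_eq (T : finType) (G : sgraph T) d x :
  x \in vset G -> deg G x = d -> (forall y, y \in vset G -> d <= deg G y) ->
  d <= nv G -> min_deg G = d.
Proof.
move=> xV dx dmin dv; apply/eqP; rewrite eqn_leq; apply/andP; split.
  rewrite /min_deg -dx; elim: (index_enum T) (mem_index_enum x) => // y s IH.
  rewrite inE big_cons => /orP[/eqP <-|/IH h]; first by rewrite xV geq_minl.
  by case: (y \in vset G) => //; apply: leq_trans h; apply: geq_minr.
by rewrite /min_deg; elim/big_ind: _ => // a b ha hb; rewrite leq_min ha.
Qed.

Theorem corollary1p6 (r : nat) (hr : 2 <= r) (T : finType) (G : sgraph T)
    (hG : minimal_class r G) :
  [/\ (ne G)%:Z%R = Num.ceil ((1 + 1 / r%:R) * (nv G)%:R - 1 : rat)%R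
      /\ Num.ceil ((1 + 1 / r%:R) * (nv G)%:R - 1 : rat)%R
         = Num.floor ((1 + 1 / r%:R) * (nv G)%:R - 1 / r%:R : rat)%R,
      min_deg G = 2
    & nv G <> 1 %[mod r] ].
Proof.
have dense := minimal_dense hG.
have sparse := minimal_edge_bound hG.
have /card_gt0P[f fE] : 0 < #|eset G|.
  by rewrite -/(ne G) lt0n; apply/eqP=> e0; rewrite e0 muln0 in dense.
have v2 : 1 < nv G.
  by have [sf <-] := esetP fE; apply: subset_leq_card.
have deg_ge x : x \in vset G -> 1 < deg G x.
  (* Comparing the two bounds gives [r.+1 < r * deg G x], which fails for degrees 0 and 1. *)
  move=> xV; have := leq_trans dense (minimal_deg_bound hG xV).
  case: (nv G) v2 => [|[|w]] //= _; rewrite mulnS addnC ltn_add2l => h.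
  by case: (deg G x) h => [|[|]] //; rewrite ?muln0 ?muln1 // ltnNge leqnSn.
have [x xV dx] : exists2 x, x \in vset G & deg G x = 2.
  have [/existsP[x /andP[xV dx]]|/existsPn h] :=
      boolP [exists x, (x \in vset G) && (deg G x <= 2)].
    by exists x => //; apply/eqP; rewrite eqn_leq dx deg_ge.
  (* If all degrees were at least 3, then [3 * nv G <= 2 * ne G]. But [r * ne G < r.+1 * nv G], and
     [3 * r >= 2 * r.+1] for [r >= 2]. *)
  exfalso; have : \sum_(x in vset G) 3 <= \sum_(x in vset G) deg G x.
    by apply: leq_sum => x xV; have := h x; rewrite xV -ltnNge.
  rewrite sum_nat_const handshake -/(nv G).
  move: (ne G) (nv G) v2 sparse => e [//|w] _ /= sparse.
  move=> /(leq_mul (leqnn r)); have := leq_mul hr (leqnn w.+1); nia.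
split.
- have [|||-> <-] := @ceil_floor_bounds r (nv G) (ne G) => //; try lia.
- exact: min_deg_eq xV dx deg_ge v2.
have := minimal_deg_bound hG xV; rewrite dx => dv.
rewrite (modn_small hr) => hmod.
move: (divn_eq (nv G) r); rewrite hmod addn1; set q := _ %/ r => nvE.
(* With [nv G = q * r + 1], density gives [ne G >= r.+1 * q + 1], hence
   [r * ne G >= r.+1 * q * r + r]. Deleting the vertex of degree 2 allows at most
   [r.+1 * q * r + r - 1]. *)
rewrite nvE /= mulnA mulnC ltn_pmul2l ?(ltnW hr) // in dense.
have := leq_mul (leqnn r) dense; move: v2 dv; rewrite nvE /=.
by case: (q * r) (mulnA r.+1 q r) => [|n] // eqn _ /=; nia.
Qed.
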